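(* Let $m$ be an integer greater than $1$, and let $\wp$ be an odd prime such that $3$ is a primitive root modulo $\wp^m$. Let $q=3^{\phi(\wp^m)}$ and $D=\{x\in\mathbb{F}_q^*:\ {\rm Tr}(x^{\frac{q-1}{\wp^m}})=0\}$. Then the dual code $\mathcal{C}_D^{\perp}$ is optimal.
   Context: $\phi$ is Euler's totient function and ${\rm Tr}$ is the trace from $\mathbb{F}_q$ onto $\mathbb{F}_3$. For $D=\{d_1,\ldots,d_n\}\subseteq\mathbb{F}_q^*$ (with $n=\#D$), $\mathcal{C}_D=\{({\rm Tr}(d_1x),\ldots,{\rm Tr}(d_nx)):\ x\in\mathbb{F}_q\}\subseteq\mathbb{F}_3^n$. The dual code $\mathcal{C}_D^{\perp}$ is the set of vectors of $\mathbb{F}_3^n$ orthogonal to all codewords of $\mathcal{C}_D$ under the standard bilinear form. An $[n,k,d]$ ternary code is a $k$-dimensional linear subspace of $\mathbb{F}_3^n$ with minimum Hamming distance $d$. A ternary code with parameters $[n,k,d]$ is called optimal if no $[n,k,d+1]$ ternary (linear) code exists. *)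

(* Defs.v *)
From HB Require Import structures.
From mathcomp Require Import all_boot all_order all_algebra all_fingroup.
From mathcomp Require Import all_solvable all_field.

Set Implicit Arguments.
Unset Strict Implicit.
Unset Printing Implicit Defensive.

Import GRing.Theory.
Local Open Scope ring_scope.

(* 'Z_N is the ring Z/N only for 1 < N. *)
Definition primitive_root (g N : nat) : Prop :=
  exists2 u : {unit 'Z_N},
    FinRing.uval u = g%:R & generator (units_Zp N) u.

Section Trace.

Variables (F : finFieldType) (s : nat) (cardF : #|F| = (3 ^ s)%N).

Lemma pchar3 : 3 \in [pchar F].
Proof. exact: card_finPcharP cardF isT. Qed.

(* F with its structure of (normal) field extension of its prime field. *)
Definition extF3 : splittingFieldType 'F_3 := pPrimeCharType pchar3.

(* galTrace takes its values in the line 1%VS of extF3; taking the coordinate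
   on 1 identifies that line with 'F_3 (see trF3E). *)
Definition trF3 (x : F) : 'F_3 :=
  coord [tuple (1 : extF3)] ord0 (galTrace 1%VS {: extF3}%VS (x : extF3)).

Lemma trF3E (x : F) :
  (trF3 x)%:A = galTrace 1%VS {: extF3}%VS (x : extF3) :> extF3.
Proof.
have gal1 : galois (1%AS : {subfield extF3}) {: extF3}%AS.
  exact: (@finField_galois _ (pPrimeCharType pchar3) 1%AS {:_}%AS (sub1v _)).
have tr1 : galTrace 1%VS {: extF3}%VS (x : extF3) \in
    span [tuple (1 : extF3)%R].
  by rewrite span_seq1; apply: mem_galTrace gal1 (memvf _).
rewrite [RHS](coord_span tr1).
by rewrite big_ord1.
Qed.

End Trace.

Section Codes.

Variable n : nat.
Implicit Types (u v : 'rV['F_3]_n) (C : {set 'rV['F_3]_n}).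

Definition hamming_dist u v : nat := #|[set i | u 0 i != v 0 i]|.

Definition min_dist C (d : nat) : Prop :=
  (exists u v, [/\ u \in C, v \in C, u != v & hamming_dist u v = d])
  /\ forall u v, u \in C -> v \in C -> u != v -> (d <= hamming_dist u v)%N.

Definition ternary_code C (k d : nat) : Prop :=
  (exists2 V : {vspace 'rV['F_3]_n}, C =i V & \dim V = k) /\ min_dist C d.

Definition optimal C : Prop :=
  exists k d, ternary_code C k d /\
    ~ exists C' : {set 'rV['F_3]_n}, ternary_code C' k d.+1.

Definition dual_code C : {set 'rV['F_3]_n} :=
  [set v : 'rV['F_3]_n | [forall c in C, \sum_i v 0 i * c 0 i == 0]].

End Codes.

(* The elements of D are numbered by enum_val : 'I_#|D| -> F. *)
Definition defset_code (F : finFieldType) (tr : F -> 'F_3) (D : {set F}) :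
    {set 'rV['F_3]_#|D|} :=
  [set \row_i tr (enum_val i * x) | x : F].

(* Main.v *)
Require Import Defs.
From HB Require Import structures.
From mathcomp Require Import all_boot all_order all_algebra all_fingroup.
From mathcomp Require Import all_solvable all_field.
From mathcomp Require Import zify.

Set Implicit Arguments.
Unset Strict Implicit.
Unset Printing Implicit Defensive.

Import GRing.Theory.
Local Open Scope ring_scope.

(** Write N = p ^ m and q = 3 ^ totient N.  The dual code is the kernel of the
    syndrome map v |-> \sum_(d in D) v_d d, with values in F
    ([mem_dual_defset_code]), so its dimension k satisfies n <= k + totient N,
    where n = #|D|.

    Its minimum distance is 2: a word of weight 1 would have a nonzero
    syndrome because 0 is not in D, while D = - D gives words of weight 2.

    A code of the same length and dimension with distance 3 would satisfy the
    sphere-packing bound 3 ^ k * (1 + 2 n) <= 3 ^ n, hence 1 + 2 n <= q.  So the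
    dual code is optimal as soon as D holds at least half of F
    ([optimal_dual_defset_code]).

    That D is so large comes from a vanishing of traces: a primitive N-th root
    of unity z has trace 0 when 1 < m.  Indeed w := z ^+ (p ^ m.-1) has order p,
    and since 3 generates the units mod N, some power of the Frobenius raises
    z to the exponent 1 + p ^ m.-1, that is, sends z to w * z; it fixes w.  So
    all the w ^+ t * z have the same trace, and their sum over t < p is 0
    ([trF3_prime_power_root_eq0]).  Hence D contains every nonzero x with
    x ^+ ((q - 1) / p) != 1, and at most (q - 1) / p elements fail this;
    as 2 < p, at least half of F remains. *)

(** * The trace onto the prime field *)

Section TraceTheory.

Variables (F : finFieldType) (s : nat) (cardF : #|F| = (3 ^ s)%N).

Local Notation tr := (trF3 cardF).

Lemma trF3_is_linear : linear (tr : extF3 cardF -> ('F_3)^o).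
Proof.
move=> a x y; rewrite /trF3 -linearP; congr (coord _ _ _).
rewrite /galTrace scaler_sumr -big_split /=.
by apply: eq_bigr => f _; rewrite linearP.
Qed.

Lemma trF3_sum n (a : 'I_n -> 'F_3) (x : 'I_n -> extF3 cardF) :
  tr (\sum_i a i *: x i) = \sum_i a i * tr (x i).
Proof.
pose T : {linear extF3 cardF -> ('F_3)^o} :=
  HB.pack (tr : extF3 cardF -> ('F_3)^o)
    (GRing.isLinear.Build _ _ _ _ _ trF3_is_linear).
by rewrite -[LHS]/(T _) linear_sum; apply: eq_bigr => i _; rewrite linearZ.
Qed.

Lemma trF30 : tr 0 = 0.
Proof.
by have := @trF3_sum 0 (fun=> 0) (fun=> 0); rewrite !big_ord0.
Qed.

(** Cubing generates the Galois group, and conjugates have the same trace. *)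
Lemma trF3_exp3 x : tr (x ^+ 3) = tr x.
Proof.
have [alpha gen_alpha alphaE] := @finField_galois_generator _
  (pPrimeCharType (pchar3 cardF)) 1%AS {:_}%AS (sub1v _).
have ax : alpha (x : extF3 cardF) = x ^+ 3.
  by rewrite alphaE ?memvf // card_Fp // dimv1.
rewrite /trF3 -ax galTrace_gal ?memvf //.
by rewrite (eqP gen_alpha) cycle_id.
Qed.

Lemma trF3_exp3X x j : tr (x ^+ (3 ^ j)) = tr x.
Proof.
by elim: j => [|j IHj]; rewrite ?expr1 // expnSr exprM trF3_exp3.
Qed.

(** Otherwise the automorphisms of F would be linearly dependent. *)
Lemma trF3_neq0 : exists x, tr x != 0.
Proof.
have [|x _ nz] := @gal_independent_contra _ (extF3 cardF) {:_}%AS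
  [in 'Gal({: extF3 cardF} / 1)]%g (fun=> 1) 1%g (group1 _).
- exact: oner_neq0.
exists x; apply: contraNneq nz => tr0.
have := trF3E cardF x; rewrite tr0 scale0r /galTrace => E.
by apply/eqP; rewrite [RHS]E; apply: eq_bigr => f _; rewrite mul1r.
Qed.

Lemma trF3_nondegenerate y : (forall x, tr (y * x) = 0) -> y = 0.
Proof.
move=> tr0; apply/eqP/idPn => nz_y; have [x] := trF3_neq0.
by rewrite -[x](mulVKf nz_y) tr0 eqxx.
Qed.

End TraceTheory.

(** * Primitive roots and traces of roots of unity *)

Lemma primitive_root_coprime g N : (1 < N)%N -> primitive_root g N ->
  coprime N g.
Proof. by move=> N_gt1 [u uE _]; rewrite -unitZpE // -uE; apply: (valP u). Qed.

Lemma primitive_root_exp g N a : (1 < N)%N -> primitive_root g N ->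
  coprime N a -> exists j, (g ^ j = a %[mod N])%N.
Proof.
move=> N_gt1 [u uE /eqP gen_u]; rewrite -unitZpE // => Ua.
have: FinRing.Unit Ua \in units_Zp N by rewrite inE.
rewrite gen_u => /cycleP[j /(congr1 val)].
rewrite FinRing.val_unitX /= uE -natrX.
move/(congr1 val); rewrite /= !Zp_nat /= Zp_cast // => Ej.
by exists j.
Qed.

(** The two conditions on z say that it has order exactly p ^ m.  The
    hypothesis 1 < m makes p divide p ^ m.-1, so that 1 + p ^ m.-1 is a unit
    mod p ^ m, equal to some 3 ^ j, and the Frobenius power x |-> x ^+ (3 ^ j)
    fixes w := z ^+ (p ^ m.-1), of order p.  The sum of the p equal
    traces of the w ^+ t * z is p times the trace of z, and p is invertible
    mod 3. *)
Lemma trF3_prime_power_root_eq0 (F : finFieldType) s (cardF : #|F| = (3 ^ s)%N)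
    (m p : nat) (z : F) : (1 < m)%N -> prime p -> primitive_root 3 (p ^ m) ->
  z ^+ (p ^ m) = 1 -> z ^+ (p ^ m.-1) != 1 -> trF3 cardF z = 0.
Proof.
move=> m_gt1 p_pr g3 zN1 w_neq1; set w := z ^+ _ in w_neq1.
have N_gt1 : (1 < p ^ m)%N by rewrite -(exp1n m) ltn_exp2r ?prime_gt1 // ltnW.
have m_gt0 := ltnW m_gt1.
have p_dvd : (p %| p ^ m.-1)%N by rewrite dvdn_exp // -ltnS prednK.
have wp1 : w ^+ p = 1 by rewrite -exprM -expnSr prednK.
have [j Ej] : exists j, (3 ^ j = 1 + p ^ m.-1 %[mod p ^ m])%N.
  apply: primitive_root_exp => //; rewrite coprimeXl //.
  by rewrite -(divnK p_dvd) addnC /coprime gcdnMDl gcdn1.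
have zj : z ^+ (3 ^ j) = w * z.
  by rewrite -(expr_mod _ zN1) Ej expr_mod // exprD expr1 mulrC.
have wj : w ^+ (3 ^ j) = w.
  rewrite -exprM mulnC exprM zj exprMn -/w -[RHS]mul1r; congr (_ * _).
  by rewrite -(divnK p_dvd) mulnC exprM wp1 expr1n.
have tr_shift t : trF3 cardF (w ^+ t * z) = trF3 cardF z.
  elim: t => [|t IHt]; first by rewrite mul1r.
  rewrite -IHt -[RHS](trF3_exp3X _ _ j) exprMn zj (exprAC w t) wj.
  by rewrite mulrA -exprSr.
(* The w ^+ t sum to 0 as w is a p-th root of unity other than 1. *)
have: trF3 cardF (\sum_(t < p) (1 : 'F_3) *: (w ^+ t * z : extF3 cardF)) = 0.
  under eq_bigr do rewrite scale1r.
  rewrite -mulr_suml; have /eqP := subrX1 w p.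
  rewrite wp1 subrr eq_sym mulf_eq0 subr_eq0 (negPf w_neq1) /= => /eqP->.
  by rewrite mul0r trF30.
rewrite trF3_sum; under eq_bigr do rewrite mul1r tr_shift.
rewrite sumr_const card_ord -mulr_natr => /eqP.
rewrite mulf_eq0 => /orP[/eqP // | /eqP p0].
have: (p%:R : 'F_3) \is a GRing.unit.
  rewrite unitFpE // coprime_sym -(coprime_pexpl _ _ m_gt0).
  exact: primitive_root_coprime.
by rewrite p0 unitr0.
Qed.

(** * The sphere-packing bound for distance 3 *)

Section SpherePacking.

Variable n : nat.
Implicit Types (u v w : 'rV['F_3]_n) (C : {set 'rV['F_3]_n}).

Lemma hamming_distC u v : hamming_dist u v = hamming_dist v u.
Proof. by apply: eq_card => i; rewrite !inE eq_sym. Qed.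

Lemma hamming_dist_triangle v u w :
  (hamming_dist u w <= hamming_dist u v + hamming_dist v w)%N.
Proof.
rewrite /hamming_dist -cardsUI; apply: leq_trans (leq_addr _ _).
apply/subset_leq_card/subsetP => i; rewrite !inE.
by apply: contraNT; rewrite negb_or !negbK => /andP[/eqP-> /eqP->].
Qed.

(** A parametrization of the vectors of weight at most 1: the nonzero scalars of
    'F_3 are the two signs. *)
Definition single_error (e : option ('I_n * bool)) : 'rV['F_3]_n :=
  if e is Some (i, b) then (-1) ^+ b *: delta_mx 0 i else 0.

Lemma hamming_dist_single_error u e :
  (hamming_dist u (u + single_error e) <= 1)%N.
Proof.
case: e => [[i b]|]; last first.
  by rewrite addr0 /hamming_dist eq_card0 // => i; rewrite !inE eqxx.
rewrite -[leqRHS](cards1 i); apply/subset_leq_card/subsetP => j.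
rewrite !inE !mxE /=.
by apply: contraNT => /negPf->; rewrite mulr0 addr0.
Qed.

Lemma single_error_inj : injective single_error.
Proof.
have nz b : (-1) ^+ b != 0 :> 'F_3 by rewrite signr_eq0.
have coordE i b j : single_error (Some (i, b)) 0 j = (-1) ^+ b *+ (j == i).
  by rewrite !mxE eqxx mulr_natr.
move=> [[i b]|] [[j c]|] // /rowP; last 2 first.
- by move/(_ i)/eqP; rewrite coordE !mxE eqxx (negPf (nz b)).
- by move/(_ j)/eqP; rewrite coordE !mxE eqxx eq_sym (negPf (nz c)).
move/(_ i)/eqP; rewrite !coordE eqxx; case: (eqVneq i j) => [<-|_]; last first.
  by rewrite (negPf (nz b)).
by case: b c => [] [].
Qed.

(** The balls of radius 1 about the codewords are disjoint, and each holds
    1 + 2 n vectors. *)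
Lemma hamming_bound C :
    {in C &, forall u v, u != v -> (3 <= hamming_dist u v)%N} ->
  (#|C| * (1 + 2 * n) <= 3 ^ n)%N.
Proof.
move=> distC; pose f (x : 'rV['F_3]_n * option ('I_n * bool)) :=
  x.1 + single_error x.2.
have f_inj : {in setX C setT &, injective f}.
  move=> [u e] [v e'] /setXP[/= Cu _] /setXP[/= Cv _]; rewrite /f /= => E.
  have uv : u = v.
    apply/eqP; apply: contraTT (leqnn 3) => /(distC _ _ Cu Cv) d3.
    rewrite -ltnNge; apply: leq_ltn_trans d3 _.
    apply: leq_ltn_trans (hamming_dist_triangle (u + single_error e) _ _) _.
    rewrite {2}E (hamming_distC _ v) ltnS.
    by apply: (@leq_add _ _ 1 1); apply: hamming_dist_single_error.
  by move: E; rewrite uv => /addrI/single_error_inj->.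
have := subset_leq_card (subsetT (f @: setX C setT)).
rewrite (card_in_imset f_inj) cardsX !cardsT card_option card_prod card_ord.
by rewrite card_bool card_mx card_Fp // mul1n (mulnC n).
Qed.

End SpherePacking.

(** * The dual of the code with defining set D *)

Section DefiningSet.

Variables (F : finFieldType) (s : nat) (cardF : #|F| = (3 ^ s)%N) (D : {set F}).

Local Notation tr := (trF3 cardF).
Local Notation L := (extF3 cardF).
Local Notation dual := (dual_code (defset_code tr D)).

Definition syndrome (v : 'rV['F_3]_#|D|) : L :=
  \sum_i v 0 i *: (enum_val i : L).

Fact syndrome_is_linear : linear syndrome.
Proof.
move=> a u v; rewrite /syndrome scaler_sumr -big_split /=.
by apply: eq_bigr => i _; rewrite !mxE scalerDl scalerA.
Qed.

HB.instance Definition _ :=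
  GRing.isLinear.Build _ _ _ _ syndrome syndrome_is_linear.

(** The product of v with the codeword of x is tr (syndrome v * x), and the
    trace form is nondegenerate. *)
Lemma mem_dual_defset_code v : (v \in dual) = (syndrome v == 0).
Proof.
have trE x : tr (syndrome v * x) =
    \sum_i v 0 i * (\row_i tr (enum_val i * x)) 0 i.
  rewrite mulr_suml; under eq_bigr do rewrite -scalerAl.
  by rewrite trF3_sum; apply: eq_bigr => i _; rewrite mxE.
rewrite inE; apply/forall_inP/eqP => [dv | s0 c /imsetP[x _ ->]].
  apply: (@trF3_nondegenerate _ _ cardF) => x; rewrite trE.
  by apply/eqP/dv/imset_f.
by rewrite -trE s0 mul0r trF30.
Qed.

Lemma dim_ker_syndrome : (#|D| <= \dim (lker (linfun syndrome)) + s)%N.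
Proof.
have dimL : \dim {:L} = s.
  by rewrite pprimeChar_dimf cardF pfactorK.
have := limg_ker_dim (linfun syndrome) fullv.
rewrite capfv dimvf dim_matrix [RHS]mul1n => {1}<-.
by rewrite leq_add2l -[leqRHS]dimL dimvS ?subvf.
Qed.

(** For x in D, the elements x and - x of D give the word of weight 2 with
    syndrome x + - x = 0; a word of weight 1 has as syndrome a nonzero multiple
    of an element of D. *)
Lemma min_dist_dual_defset_code :
    0 \notin D -> {in D, forall x, - x \in D} -> D != set0 ->
  min_dist dual 2.
Proof.
move=> D0 Dopp /set0Pn[x Dx]; split.
  pose i := enum_rank_in Dx x; pose j := enum_rank_in Dx (- x).
  have di : enum_val i = x by rewrite enum_rankK_in.
  have dj : enum_val j = - x by rewrite enum_rankK_in ?Dopp.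
  have neq_ij : i != j.
    apply: contraNneq D0 => ij; suff <- : x = 0 by [].
    have xN : x = - x by rewrite -dj -ij di.
    have := mulrn_pchar (pchar3 cardF) x.
    by rewrite mulrSr mulr2n {1}xN addNr add0r.
  pose v : 'rV['F_3]_#|D| := delta_mx 0 i + delta_mx 0 j.
  have supp_v k : (0 != v 0 k) = (k \in [set i; j]).
    rewrite !inE !mxE /=; case: (eqVneq k i) => [->|_]; last first.
      by rewrite add0r; case: (k == j).
    by rewrite (negPf neq_ij) addr0.
  exists 0, v; split.
  - by rewrite mem_dual_defset_code linear0.
  - rewrite mem_dual_defset_code linearD /= /syndrome.
    rewrite (bigD1 i) //= [X in _ + X](bigD1 j) //= !mxE !eqxx.
    rewrite big1 => [|k /negPf ki]; last by rewrite !mxE ki andbF scale0r.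
    rewrite big1 => [|k /negPf kj]; last by rewrite !mxE kj andbF scale0r.
    by rewrite !addr0 !scale1r di dj subrr.
  - apply/eqP => v0; have := supp_v i; rewrite -v0 mxE eqxx.
    by rewrite !inE eqxx.
  - transitivity #|[set i; j]|; last by rewrite cards2 neq_ij.
    by apply: eq_card => k; rewrite !inE mxE supp_v !inE.
move=> u v; rewrite !mem_dual_defset_code => /eqP su /eqP sv neq_uv.
rewrite leqNgt; apply: contraNN D0; rewrite ltnS => d1.
have [i neq_i] : exists i, u 0 i != v 0 i.
  apply/existsP; apply: contraNT neq_uv; rewrite negb_exists => /forallP uv.
  by apply/eqP/rowP => i; apply/eqP; have := uv i; rewrite negbK.
have supp_uv : [set i] = [set k | u 0 k != v 0 k].
  by apply/eqP; rewrite eqEcard cards1 d1 sub1set inE neq_i.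
have : syndrome (u - v) = 0 by rewrite linearB /= su sv subrr.
rewrite /syndrome (bigD1 i) //= big1 => [|k ki]; last first.
  have /setP/(_ k) := supp_uv; rewrite !inE (negPf ki) => /esym/negbFE/eqP uv.
  by rewrite !mxE uv subrr scale0r.
move/eqP; rewrite addr0 scaler_eq0 !mxE subr_eq0 (negPf neq_i) /= => /eqP <-.
exact: enum_valP.
Qed.

(** With k = \dim (lker (linfun syndrome)), a code of dimension k and distance 3
    would give 3 ^ k * (1 + 2 n) <= 3 ^ n <= 3 ^ k * 3 ^ s, hence
    1 + 2 n <= 3 ^ s. *)
Lemma optimal_dual_defset_code :
    0 \notin D -> {in D, forall x, - x \in D} -> (3 ^ s <= 2 * #|D|)%N ->
  optimal dual.
Proof.
move=> D0 Dopp largeD; pose V := lker (linfun syndrome).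
exists (\dim V), 2; split.
  split; first by exists V => // v; rewrite mem_dual_defset_code memv_ker lfunE.
  apply: min_dist_dual_defset_code => //; rewrite -card_gt0.
  by rewrite -(ltn_pmul2l (isT : 0 < 2)%N) muln0 (leq_trans _ largeD) ?expn_gt0.
case=> C' [[V' C'V' dimV'] [_ distC']].
have := hamming_bound distC'.
rewrite (eq_card C'V') card_vspace card_Fp // dimV'.
apply/negP; rewrite -ltnNge.
have leq_n : (3 ^ #|D| <= 3 ^ \dim V * 3 ^ s)%N.
  by rewrite -expnD leq_exp2l // dim_ker_syndrome.
apply: leq_ltn_trans leq_n _.
by rewrite ltn_pmul2l ?expn_gt0 // ltnS.
Qed.

End DefiningSet.

(** * The optimal codes *)

Theorem corollary5p3 (m p : nat) (hm : (1 < m)%N) (hp : prime p)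
    (hodd : odd p) (h3 : primitive_root 3 (p ^ m))
    (F : finFieldType) (hF : #|F| = (3 ^ totient (p ^ m))%N)
    (D : {set F})
    (hD : D = [set x : F | (x != 0)
       && (trF3 hF (x ^+ ((3 ^ totient (p ^ m) - 1) %/ (p ^ m))%N) == 0)]) :
  optimal (dual_code (defset_code (trF3 hF) D)).
Proof.
have p_gt0 := prime_gt0 hp; have m_gt0 := ltnW hm.
have N_gt1 : (1 < p ^ m)%N by rewrite -(exp1n m) ltn_exp2r ?prime_gt1.
have oddN : odd (p ^ m) by rewrite oddX hodd orbT.
set q := (3 ^ totient (p ^ m))%N in hF hD *.
have q_gt0 : (0 < q)%N by rewrite expn_gt0.
set e := ((q - 1) %/ p ^ m)%N in hD.
have eN : (e * p ^ m = q - 1)%N.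
  apply: divnK; rewrite -eqn_mod_dvd //; apply/eqP/Euler_exp_totient.
  by rewrite coprime_sym primitive_root_coprime.
have F1 (x : F) : x != 0 -> x ^+ (q - 1) = 1.
  move=> nz_x; apply: (mulfI nz_x).
  by rewrite -exprS subn1 prednK // -hF expf_card mulr1.
(* D is closed under opposite because (-1) ^+ e = 1. *)
have even_e : ~~ odd e.
  suff: ~~ odd (e * p ^ m) by rewrite oddM oddN andbT.
  by rewrite eN oddB // oddX orbT.
apply: optimal_dual_defset_code; first by rewrite hD inE eqxx.
  by move=> x; rewrite hD !inE oppr_eq0 exprNn -signr_odd (negPf even_e) mul1r.
pose k := (e * p ^ m.-1)%N.
have kp : (p * k = q - 1)%N by rewrite mulnC -mulnA -expnSr prednK.
have q_gt1 : (0 < q - 1)%N.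
  by rewrite subn_gt0 -hF; apply: finNzRing_gt1.
have k_gt0 : (0 < k)%N by move: q_gt1; rewrite -kp muln_gt0 => /andP[].
(* The elements outside D are 0 or roots of 'X^k - 1, where p * k = q - 1. *)
pose R := [set x : F | x ^+ k == 1].
have cardR : (#|R| <= k)%N.
  rewrite cardE; apply: max_unity_roots; rewrite ?enum_uniq //.
  by apply/allP => x; rewrite mem_enum inE unity_rootE.
have sub_D : [set~ 0] :\: R \subset D.
  apply/subsetP => x; rewrite !inE hD inE => /andP[xk nz_x]; rewrite nz_x /=.
  apply/eqP/(trF3_prime_power_root_eq0 _ hm hp h3); rewrite -exprM //.
  by rewrite eN F1.
have cardD : (q - 1 <= #|D| + k)%N.
  have <- : #|[set~ (0 : F)]| = (q - 1)%N by rewrite cardsC1 hF subn1.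
  rewrite -(cardsID R) addnC leq_add ?subset_leq_card //.
  by apply: leq_trans cardR; apply: subset_leq_card; apply: subsetIr.
have p_gt2 : (2 < p)%N by clear -hp hodd; case: p hp hodd => [|[|[|]]].
have : (3 * k <= q - 1)%N by rewrite -kp leq_mul2r p_gt2 orbT.
rewrite -/q; lia.
Qed.
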